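(* Let $\rho = \rho_{AB}$ be a bipartite quantum state on $A\otimes B$, where $A\cong B\cong\mathbb{C}^d$, and write $\eta = D_H^2(\rho\|\rho_A\otimes\rho_B)$. Then $I(A:B)_\rho \le \eta\cdot O(\log(d/\eta))$.
   Context: $\rho_A,\rho_B$ denote the partial traces of $\rho$. $D_H^2(\rho\|\sigma) = \mathrm{tr}((\sqrt\rho-\sqrt\sigma)^2)$ is the squared quantum Hellinger distance. $I(A:B)_\rho = D_{KL}(\rho\|\rho_A\otimes\rho_B)$ with $D_{KL}(\rho\|\sigma) = \mathrm{tr}(\rho(\ln\rho-\ln\sigma))$. The $O(\cdot)$ hides a universal constant. *)

(* Defs.v *)
From mathcomp Require Import all_boot all_algebra.
From mathcomp Require Import complex mxtens.
From mathcomp Require Import reals exp.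
Set Implicit Arguments.
Unset Strict Implicit.
Unset Printing Implicit Defensive.
Import GRing.Theory Num.Theory Num.Def.
Local Open Scope ring_scope.
Local Open Scope complex_scope.

Section Quantum.
Variable R : realType.
Local Notation C := R[i].

Definition density_mx n (rho : 'M[C]_n) : Prop :=
  [/\ rho \is hermsymmx,
      (forall v : 'rV[C]_n, 0 <= (v *m rho *m (map_mx conjC v^T)) 0 0)
    & \tr rho = 1].

(* functional calculus for a normal (here: Hermitian) matrix via its spectral
   decomposition A = P^-1 diag(lambda) P, applying f to the (real) eigenvalues *)
Definition mxfun (f : R -> R) n (A : 'M[C]_n) : 'M[C]_n :=
  let P := spectralmx A in
  invmx P *m diag_mx (map_mx (fun z : C => (f (complex.Re z))%:C) (spectral_diag A))
    *m P.

(* natural log with the support convention log 0 := 0 (used only for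
   eigenvalues; on a PSD matrix this is the log on the support) *)
Definition ln0 (x : R) : R := if 0 < x then ln x else 0.

Definition mxsqrt n (A : 'M[C]_n) := mxfun (@Num.sqrt R) A.
Definition mxlog n (A : 'M[C]_n) := mxfun ln0 A.

Definition ptrB d d' (rho : 'M[C]_(d * d')) : 'M[C]_d :=
  \matrix_(i, k) \sum_(j < d') rho (mxtens_index (i, j)) (mxtens_index (k, j)).
Definition ptrA d d' (rho : 'M[C]_(d * d')) : 'M[C]_d' :=
  \matrix_(j, l) \sum_(i < d) rho (mxtens_index (i, j)) (mxtens_index (i, l)).

Definition hellinger2 n (rho sigma : 'M[C]_n) : R :=
  complex.Re (\tr ((mxsqrt rho - mxsqrt sigma) ^+ 2)).

Definition relent n (rho sigma : 'M[C]_n) : R :=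
  complex.Re (\tr (rho *m (mxlog rho - mxlog sigma))).

Definition mutinf d d' (rho : 'M[C]_(d * d')) : R :=
  relent rho (ptrB rho *t ptrA rho).

End Quantum.

(* Main.v *)
(* Let u_i, p_i be the eigenvectors and eigenvalues of rho, and v_j, q_j those
   of rho_A (x) rho_B, where v_j is a product vector and q_j = a_k b_l for
   j = (k, l). The overlaps W_ij = |<u_i, v_j>|^2 form a doubly stochastic
   matrix and (Nussbaum-Szkola)
     I = sum_ij W_ij p_i (ln p_i - ln q_j),
     eta = sum_ij W_ij (sqrt p_i - sqrt q_j)^2,
   so the question is about real sums. Where p_i <= 4 q_j, the summand
   p ln (p / q) - p + q is at most 5 (sqrt p - sqrt q)^2. The mass
   s_ij = W_ij p_i of the remaining pairs has sum at most 4 eta, and there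
   ln (p_i / q_j) <= - ln a_k - ln b_l. The k-th marginal s_k of s is at most
   a_k because a is the marginal of W p; hence, with t = eta / d,
   s_k (- ln a_k) <= s_k ln (1 / t) + t, and summing over the d values of k
   gives at most 4 eta ln (d / eta) + eta. Finally d / eta >= 4/3 for d >= 2,
   because eta <= 2 - 2 / d^2, so ln (d / eta) absorbs the constants. *)
Require Import Defs.
From mathcomp Require Import all_boot all_order all_algebra.
From mathcomp Require Import complex mxtens.
From mathcomp Require Import reals exp.
From mathcomp Require Import ring lra.
Set Implicit Arguments.
Unset Strict Implicit.
Unset Printing Implicit Defensive.
(* Defs comes again because exp also has a constant named ln0. *)
Import Defs Order.TTheory GRing.Theory Num.Theory.
Local Open Scope ring_scope.

(** * Estimates on real sums *)

Section RealEstimates.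
Variable R : realType.
Implicit Types x y p q s t : R.

Lemma ln_le_subr1 x : 0 < x -> ln x <= x - 1.
Proof. by move=> x0; have := @le_ln1Dx R (x - 1); rewrite [1 + _]addrC subrK; apply; lra. Qed.

Lemma ln_ge_1subV x : 0 < x -> 1 - x^-1 <= ln x.
Proof.
move=> x0; have := @ln_le_subr1 x^-1; rewrite invr_gt0 lnV ?posrE// => /(_ x0).
lra.
Qed.

Lemma ln0_ln x : 0 < x -> ln0 x = ln x.
Proof. by rewrite /ln0 => ->. Qed.

Lemma ln0_le0 x : x <= 1 -> ln0 x <= 0.
Proof. by move=> x1; rewrite /ln0; case: ifP => // x0; exact: ln_le0. Qed.

Lemma ln0M x y : 0 < x -> 0 < y -> ln0 (x * y) = ln0 x + ln0 y.
Proof. by move=> x0 y0; rewrite !ln0_ln ?mulr_gt0// lnM. Qed.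

(* With [x = sqrt (p / q) <= 2] and [ln x <= x - 1], the left-hand side is at
   most [q (x - 1)^2 (2 x + 1)]. *)
Lemma entropy_term_le p q : 0 <= p -> 0 < q -> p <= 4 * q ->
  p * (ln0 p - ln0 q) - p + q <= 5 * (Num.sqrt p - Num.sqrt q) ^+ 2.
Proof.
move=> p0 q0 pq; have [{p0}p0|p0'] := ltP 0 p; last first.
  have -> : p = 0 by apply/le_anti; rewrite p0' p0.
  rewrite sqrtr0 mul0r !sub0r oppr0 add0r sqrrN sqr_sqrtr ?ltW//; lra.
have sq0 : 0 < Num.sqrt q by rewrite sqrtr_gt0.
have sp0 : 0 < Num.sqrt p by rewrite sqrtr_gt0.
set x := Num.sqrt p / Num.sqrt q.
have x0 : 0 < x by rewrite divr_gt0.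
have spE : Num.sqrt p = x * Num.sqrt q by rewrite divfK ?gt_eqF.
have pE : p = x ^+ 2 * q.
  by rewrite -[LHS]sqr_sqrtr ?ltW// spE exprMn sqr_sqrtr ?ltW.
have x2 : x <= 2.
  have : x ^+ 2 <= 4 by rewrite -(ler_pM2r q0) -pE.
  nra.
have -> : ln0 p - ln0 q = 2 * ln x.
  by rewrite !ln0_ln// pE lnM ?posrE ?exprn_gt0// lnXn// addrK mulr_natl.
have -> : (Num.sqrt p - Num.sqrt q) ^+ 2 = (x - 1) ^+ 2 * q.
  by rewrite spE -[in RHS](sqr_sqrtr (ltW q0)); ring.
rewrite pE.
have lx := ln_le_subr1 x0.
have h : x ^+ 2 * ln x <= x ^+ 2 * (x - 1) by rewrite ler_wpM2l// sqr_ge0.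
have -> : x ^+ 2 * q * (2 * ln x) - x ^+ 2 * q + q
   = (2 * (x ^+ 2 * ln x) - x ^+ 2 + 1) * q by ring.
rewrite [leRHS]mulrA ler_pM2r//.
have : 0 <= (2 - x) * (x - 1) ^+ 2 by rewrite mulr_ge0 ?sqr_ge0// subr_ge0.
nra.
Qed.

(** Here [sqrt q] is at most half of [sqrt p], so the difference is at least [sqrt p / 2]. *)
Lemma le_sqr_sqrt_sub p q : 0 <= q -> 4 * q <= p ->
  p <= 4 * (Num.sqrt p - Num.sqrt q) ^+ 2.
Proof.
move=> q0 qp; have p0 : 0 <= p by lra.
have h : 2 * Num.sqrt q <= Num.sqrt p.
  rewrite -(@ler_pXn2r _ 2) ?nnegrE ?mulr_ge0 ?sqrtr_ge0//.
  by rewrite exprMn !sqr_sqrtr//; lra.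
have := sqrtr_ge0 q; have := sqrtr_ge0 p; have := sqr_sqrtr p0.
nra.
Qed.

(** Write [- ln a = ln t^-1 + ln (t / a)] and use [ln (t / a) <= t / a - 1]: since [s <= a],
    replacing [a] by [t] costs at most [t]. If [a <= 0], then [s = 0]. *)
Lemma mul_oppln0_le s a t : 0 <= s -> s <= a -> 0 < t ->
  s * - ln0 a <= s * ln t^-1 + t.
Proof.
move=> s0 sa t0; have [a0|a0] := ltP 0 a; last first.
  have -> : s = 0 by lra.
  by rewrite !mul0r add0r ltW.
rewrite ln0_ln//; have ta0 : 0 < t / a by rewrite divr_gt0.
have := ln_le_subr1 ta0; rewrite ln_div// lnV// => h.
have : s * (ln t - ln a) <= s * (t / a - 1) by rewrite ler_wpM2l.
have : s * (t / a) <= t.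
  by rewrite mulrCA ger_pMr// ler_pdivrMr// mul1r.
nra.
Qed.

End RealEstimates.

(** * The inequality for a doubly stochastic coupling of two spectra *)

Section Coupling.
Variables (R : realType) (I J : finType) (d : nat).
Variables (alpha beta : J -> 'I_d) (p : I -> R) (a b : 'I_d -> R).
Variable W : I -> J -> R.
Let q j := a (alpha j) * b (beta j).
(** When [W] consists of overlaps, this is the diagonal of rho in the eigenbasis of the product
    state. *)
Let r j := \sum_i W i j * p i.
Hypothesis cardJ : #|J| = (d * d)%N.
Hypothesis W_ge0 : forall i j, 0 <= W i j.
Hypothesis W_row : forall i, \sum_j W i j = 1.
Hypothesis W_col : forall j, \sum_i W i j = 1.
Hypothesis p_ge0 : forall i, 0 <= p i.
Hypothesis p_sum : \sum_i p i = 1.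
Hypothesis q_sum : \sum_j q j = 1.
Hypothesis a_marg : forall k, a k = \sum_(j | alpha j == k) r j.
Hypothesis b_marg : forall k, b k = \sum_(j | beta j == k) r j.

Let hell := \sum_i \sum_j W i j * (Num.sqrt (p i) - Num.sqrt (q j)) ^+ 2.
Let kl := \sum_i \sum_j W i j * (p i * (ln0 (p i) - ln0 (q j))).

Lemma coupling_p_le1 i : p i <= 1.
Proof. by rewrite -p_sum (bigD1 i)//= lerDl sumr_ge0. Qed.

Lemma joint_ge0 i j : 0 <= W i j * p i.
Proof. by rewrite mulr_ge0. Qed.

Lemma joint_le_diag i j : W i j * p i <= r j.
Proof. by rewrite /r (bigD1 i)//= lerDl sumr_ge0// => k _; exact: joint_ge0. Qed.

Lemma diag_ge0 j : 0 <= r j.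
Proof. by rewrite /r sumr_ge0// => i _; exact: joint_ge0. Qed.

Lemma diag_le_a j : r j <= a (alpha j).
Proof.
by rewrite a_marg (bigD1 j)//= lerDl sumr_ge0// => k _; exact: diag_ge0.
Qed.

Lemma diag_le_b j : r j <= b (beta j).
Proof.
by rewrite b_marg (bigD1 j)//= lerDl sumr_ge0// => k _; exact: diag_ge0.
Qed.

(** Both marginals of [r] dominate [r j]. This gives the sign of [q j], on which no hypothesis is
    made directly. *)
Lemma sqr_diag_le j : r j ^+ 2 <= q j.
Proof. by rewrite expr2 ler_pM ?diag_ge0 ?diag_le_a ?diag_le_b. Qed.

Lemma q_ge0 j : 0 <= q j.
Proof. exact: le_trans (sqr_ge0 _) (sqr_diag_le j). Qed.

Lemma sum_joint : \sum_i \sum_j W i j * p i = 1.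
Proof. by under eq_bigr do rewrite -mulr_suml W_row mul1r. Qed.

Lemma sum_diag : \sum_j r j = 1.
Proof. by rewrite /r exchange_big sum_joint. Qed.

Lemma coupling_dim_gt0 : (0 < d)%N.
Proof.
rewrite lt0n; apply/eqP => d0; have /eqP := sum_diag.
by rewrite big1 ?(eq_sym 0) ?oner_eq0// => j; case: (alpha j); rewrite d0.
Qed.

Lemma sum_coupling_q : \sum_i \sum_j W i j * q j = 1.
Proof. by rewrite exchange_big /=; under eq_bigr do rewrite -mulr_suml W_col mul1r. Qed.

Lemma hell_ge0 : 0 <= hell.
Proof. by do 2![apply: sumr_ge0 => ? _]; rewrite mulr_ge0 ?sqr_ge0. Qed.

(** Since [p i <= 1] and [r j ^+ 2 <= q j], the cross term is at least [2 * \sum_j r j ^+ 2], which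
    is at least [2 / d ^ 2] because [r] sums to 1 over [d ^ 2] indices. *)
Lemma hell_le : hell <= 2 - 2 * (d%:R ^- 2).
Proof.
have le_term i j : W i j * (Num.sqrt (p i) - Num.sqrt (q j)) ^+ 2 <=
    W i j * p i + W i j * q j - 2 * (W i j * p i * r j).
  have -> : W i j * p i + W i j * q j - 2 * (W i j * p i * r j) =
    W i j * (p i + q j - 2 * (p i * r j)) by ring.
  rewrite ler_wpM2l// sqrrB !sqr_sqrtr ?q_ge0// addrAC lerD2l lerN2.
  rewrite -[leRHS]mulr_natl ler_wpM2l//.
  apply: ler_pM => //; first exact: diag_ge0.
    rewrite -[leLHS]ger0_norm// -sqrtr_sqr ler_wsqrtr//.
    by have := p_ge0 i; have := coupling_p_le1 i; nra.
  by rewrite -[leLHS]ger0_norm ?diag_ge0// -sqrtr_sqr ler_wsqrtr// sqr_diag_le.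
have le_hell : hell <= 2 - 2 * \sum_j r j ^+ 2.
  apply: (le_trans (ler_sum _ (fun i _ => ler_sum _ (fun j _ => le_term i j)))).
  under eq_bigr do rewrite sumrB big_split /=.
  rewrite sumrB big_split /= sum_joint sum_coupling_q lerD2l lerN2.
  under [leRHS]eq_bigr do rewrite -mulr_sumr.
  rewrite -mulr_sumr exchange_big /=.
  by under [X in _ <= _ * X]eq_bigr do rewrite -mulr_suml -/(r _) -expr2.
(* The tangent to the square at [d ^- 2], the mean of [r]; summed over [J] it gives
   [d ^- 2 <= \sum_j r j ^+ 2]. *)
have le_sqr j : 2 * d%:R ^- 2 * r j - d%:R ^- 2 ^+ 2 <= r j ^+ 2.
  by have := sqr_ge0 (r j - d%:R ^- 2); nra.
have := ler_sum (index_enum J) (P := predT) (fun j _ => le_sqr j).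
rewrite sumrB -mulr_sumr sum_diag sumr_const cardJ mulr1 => le_sum.
move: le_sum; rewrite -[_ *+ (d * d)]mulr_natr natrM -expr2.
rewrite [_ ^- 2 ^+ 2]expr2 mulfVK ?expf_neq0 ?pnatr_eq0 -?lt0n ?coupling_dim_gt0//.
lra.
Qed.

(* [c] and [gamma] are [a] and [alpha], or [b] and [beta]. *)
Lemma sum_opp_ln0_marginal_le (c : 'I_d -> R) (gamma : J -> 'I_d)
    (s : I -> J -> R) (t : R) :
  (forall k, c k = \sum_(j | gamma j == k) r j) ->
  (forall i j, 0 <= s i j <= W i j * p i) -> 0 < t ->
  \sum_i \sum_j s i j * - ln0 (c (gamma j)) <=
  (\sum_i \sum_j s i j) * ln t^-1 + d%:R * t.
Proof.
move=> c_marg s_bnd t0.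
have s0 i j : 0 <= s i j by have /andP[] := s_bnd i j.
rewrite exchange_big [X in _ <= X * _ + _]exchange_big /=.
(* On each fibre of [gamma] the logarithm is constant and the mass of [s] is at most [c k]; each of
   the [d] fibres contributes one [t]. *)
rewrite (partition_big gamma predT)//= [X in _ <= X * _ + _](partition_big gamma predT)//=.
rewrite mulr_suml -[d in d%:R](card_ord d) mulr_natl -sumr_const -big_split /=.
apply: ler_sum => k _.
rewrite (eq_bigr (fun j => (\sum_i s i j) * - ln0 (c k))); last first.
  by move=> j /eqP <-; rewrite mulr_suml.
rewrite -mulr_suml; apply: mul_oppln0_le => //.
  by do 2![apply: sumr_ge0 => ? _].
rewrite c_marg; apply: ler_sum => j _; apply: ler_sum => i _.
by have /andP[] := s_bnd i j.
Qed.

Let s i j := if 4 * q j < p i then W i j * p i else 0.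

(** The added [- W p + W q] sums to zero over all pairs. For [p <= 4 q] it cancels the first-order
    part of the logarithmic term; otherwise it is at most 0, and [ln p <= 0] leaves only
    [- ln q]. *)
Lemma kl_term_le i j :
  W i j * (p i * (ln0 (p i) - ln0 (q j))) - W i j * p i + W i j * q j <=
  5 * (W i j * (Num.sqrt (p i) - Num.sqrt (q j)) ^+ 2) +
  (s i j * - ln0 (a (alpha j)) + s i j * - ln0 (b (beta j))).
Proof.
have [W0|W0] := eqVneq (W i j) 0.
  by rewrite /s W0; case: ifP => _; rewrite !mul0r ?mulr0 !addr0 subr0.
have {}W0 : 0 < W i j by rewrite lt0r W0 W_ge0.
rewrite -mulrBr -mulrDr [5 * _]mulrCA /s; case: (ltP (4 * q j)) => [q4|p4]; last first.
  rewrite !mul0r !addr0 ler_pM2l//.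
  have := q_ge0 j; rewrite le_eqVlt => /predU1P[q0|q0]; last exact: entropy_term_le.
  have -> : p i = 0.
    by apply/le_anti; rewrite p_ge0 andbT; move: p4; rewrite -q0 mulr0.
  by rewrite -q0 mul0r sqrtr0 !subr0 expr0n mulr0 addr0.
have p0 : 0 < p i by apply: le_lt_trans q4; rewrite mulr_ge0 ?q_ge0.
(* Positivity of [r j] passes to both marginals, so the logarithm of [q j] splits. *)
have r0 : 0 < r j by apply: lt_le_trans (joint_le_diag i j); exact: mulr_gt0.
rewrite -mulrDr -mulrA -!mulrDr ler_pM2l//.
rewrite /q ln0M ?(lt_le_trans r0) ?diag_le_a ?diag_le_b//.
have := ln0_le0 (coupling_p_le1 i).
have := sqr_ge0 (Num.sqrt (p i) - Num.sqrt (a (alpha j) * b (beta j))).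
rewrite -/(q j) => h1 h2.
have : p i * ln0 (p i) <= 0 by rewrite mulr_ge0_le0.
have := q_ge0 j.
lra.
Qed.

Lemma kl_le_hell : kl <= 36 * hell * ln (d%:R / hell).
Proof.
have s_bnd i j : 0 <= s i j <= W i j * p i.
  by rewrite /s; case: ifP => _; rewrite ?joint_ge0 ?lexx.
have kl_le : kl <= 5 * hell + (\sum_i \sum_j s i j * - ln0 (a (alpha j))
                             + \sum_i \sum_j s i j * - ln0 (b (beta j))).
  have -> : kl = \sum_i \sum_j
    (W i j * (p i * (ln0 (p i) - ln0 (q j))) - W i j * p i + W i j * q j).
    under [RHS]eq_bigr do rewrite big_split /= sumrB.
    by rewrite big_split /= sumrB sum_joint sum_coupling_q subrK.
  rewrite /hell mulr_sumr -!big_split /=; apply: ler_sum => i _.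
  rewrite mulr_sumr -!big_split /=; apply: ler_sum => j _; exact: kl_term_le.
have s_le i j : s i j <= 4 * (W i j * (Num.sqrt (p i) - Num.sqrt (q j)) ^+ 2).
  rewrite /s; case: ifP => [q4|_]; last by rewrite mulr_ge0// mulr_ge0// sqr_ge0.
  by rewrite mulrCA ler_wpM2l// le_sqr_sqrt_sub ?q_ge0// ltW.
have sum_s : \sum_i \sum_j s i j <= 4 * hell.
  rewrite /hell mulr_sumr; apply: ler_sum => i _.
  by rewrite mulr_sumr; apply: ler_sum => j _.
(* If [hell = 0], the right-hand side is 0 whatever value the logarithm of [d / 0] has; then [s]
   vanishes and the bound on [kl] is 0. *)
have := hell_ge0; rewrite le_eqVlt => /predU1P[hell0|hell_gt0].
  rewrite -hell0 mulr0 mul0r; apply: (le_trans kl_le); rewrite -hell0 mulr0 add0r.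
  have s0 i j : s i j = 0.
    apply/le_anti; have /andP[-> _] := s_bnd i j; rewrite andbT.
    have sum_s0 : \sum_i \sum_j s i j <= 0 by move: sum_s; rewrite -hell0 mulr0.
    apply: le_trans sum_s0.
    have ss i' j' : 0 <= s i' j' by have /andP[] := s_bnd i' j'.
    by rewrite (bigD1 i)//= (bigD1 j)//= -addrA lerDl addr_ge0// ?sumr_ge0// => ? _; rewrite ?sumr_ge0.
  by rewrite !big1 ?addr0// => i _; rewrite big1// => j _; rewrite s0 mul0r.
have d2 : 1 < d%:R :> R.
  rewrite ltr1n ltnNge; apply/negP => d1; move: hell_gt0; apply/negP; rewrite -leNgt.
  apply: (le_trans hell_le).
  have -> : d = 1%N by apply/eqP; rewrite eqn_leq d1 coupling_dim_gt0.
  by rewrite expr1n invr1 mulr1 subrr.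
(* The lower bound [d / (2 - 2 / d ^ 2)] equals 4/3 at [d = 2], the smallest dimension left. *)
have ratio : 4 / 3 <= d%:R / hell.
  have d0 : 0 < d%:R :> R by lra.
  rewrite ler_pdivlMr//.
  have d2' : 2 <= d%:R :> R by rewrite ler_nat; move: d2; rewrite ltr1n.
  have h := hell_le.
  have v0 : 0 < d%:R ^- 2 :> R by rewrite invr_gt0 exprn_gt0.
  have vE : d%:R ^- 2 * d%:R ^+ 2 = 1 :> R by rewrite mulVf// expf_neq0// gt_eqF.
  have : 4 / 3 * (2 - 2 * d%:R ^- 2) <= d%:R :> R.
    rewrite -(ler_pM2r (exprn_gt0 2 d0)).
    have -> : 4 / 3 * (2 - 2 * d%:R ^- 2) * d%:R ^+ 2 =
      4 / 3 * (2 * d%:R ^+ 2 - 2 * (d%:R ^- 2 * d%:R ^+ 2)) :> R by ring.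
    rewrite vE.
    (* After multiplication by [d ^ 2], right side minus left side is exactly this product; the
       factor [d - 2] reflects equality at 2. *)
    have : 0 <= (d%:R - 2) * (d%:R ^+ 2 - 2 / 3 * d%:R - 4 / 3) :> R.
      by rewrite mulr_ge0 ?subr_ge0//; nra.
    rewrite -subr_ge0 => h'; rewrite -subr_ge0; apply: le_trans h' _.
    by rewrite le_eqVlt; apply/orP; left; apply/eqP; field.
  lra.
set L := ln (d%:R / hell).
(* The constant is [1 - (4 / 3)^-1]. *)
have L_ge : 4^-1 <= L.
  have := @ln_ge_1subV R (d%:R / hell).
  have ratio0 : 0 < d%:R / hell by lra.
  have : (d%:R / hell)^-1 <= (4 / 3)^-1 by rewrite lef_pV2 ?posrE//; lra.
  rewrite -/L => h1 /(_ ratio0) h2; lra.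
(* With [t = hell / d], each marginal costs at most [4 * hell * L + hell]. The total
   [7 * hell + 8 * hell * L] is at most [36 * hell * L], since [hell <= 4 * hell * L]. *)
have t0 : 0 < hell / d%:R by rewrite divr_gt0//; lra.
have := sum_opp_ln0_marginal_le a_marg s_bnd t0.
have := sum_opp_ln0_marginal_le b_marg s_bnd t0.
rewrite invf_div -/L [d%:R * _]mulrC divfK ?gt_eqF//; last by lra.
have : (\sum_i \sum_j s i j) * L <= 4 * hell * L by rewrite ler_wpM2r//; lra.
have : hell <= 4 * (hell * L) by nra.
nra.
Qed.

End Coupling.

(** * Spectral calculus *)

Section FunctionalCalculus.
Local Open Scope complex_scope.
Local Open Scope sesquilinear_scope.
Variable R : realType.
Local Notation C := R[i].

Lemma mulmx_unitaryV n (P : 'M[C]_n) : P \is unitarymx -> P^t* *m P = 1%:M.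
Proof. by move=> uP; rewrite -invmx_unitary// mulVmx// unitarymx_unit. Qed.

(* The change of basis V between two diagonalizations of the same matrix only
   links equal eigenvalues. *)
Lemma map_unitary_diag (f : C -> C) n (P Q : 'M[C]_n) (l m : 'rV[C]_n) :
  P \is unitarymx -> Q \is unitarymx ->
  Q^t* *m diag_mx m *m Q = P^t* *m diag_mx l *m P ->
  Q^t* *m diag_mx (map_mx f m) *m Q = P^t* *m diag_mx (map_mx f l) *m P.
Proof.
move=> uP uQ PQ.
have [V [VE QE PE]] : exists V, [/\ V = Q *m P^t*, Q = V *m P & P^t* = Q^t* *m V].
  exists (Q *m P^t*); split; [by [] | by rewrite -mulmxA (mulmx_unitaryV uP) mulmx1 |].
  by rewrite mulmxA (mulmx_unitaryV uQ) mul1mx.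
have comm : diag_mx m *m V = V *m diag_mx l.
  transitivity (Q *m (Q^t* *m diag_mx m *m Q) *m P^t*).
    by rewrite VE (mulmxA Q) (mulmxA Q) (unitarymxP uQ) mul1mx !mulmxA.
  by rewrite PQ !mulmxA -VE -(mulmxA _ P) (unitarymxP uP) mulmx1.
have commf : diag_mx (map_mx f m) *m V = V *m diag_mx (map_mx f l).
  apply/matrixP => i j; move/matrixP/(_ i j): comm.
  rewrite !mul_diag_mx !mul_mx_diag !mxE.
  rewrite [RHS]mulrC => /eqP; rewrite -subr_eq0 -mulrBl mulf_eq0 subr_eq0.
  by case/orP => /eqP->; rewrite ?mulr0 ?mul0r// mulrC.
by rewrite {2}QE PE mulmxA -(mulmxA (Q^t*) (diag_mx _)) commf (mulmxA (Q^t*)).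
Qed.

(** The definition of [mxfun] fixes the basis chosen by [spectralmx]; this frees it, so that a basis
    of product vectors can be used. *)
Lemma mxfun_unitary_diag (f : R -> R) n (A P : 'M[C]_n) (l : 'rV[C]_n) :
  P \is unitarymx -> A = P^t* *m diag_mx l *m P ->
  mxfun f A = P^t* *m diag_mx (map_mx (fun z : C => (f (complex.Re z))%:C) l) *m P.
Proof.
move=> uP AE.
have /orthomx_spectralP : A \is normalmx.
  apply/orthomx_spectral_subproof; exists (P, l) => //=.
  by rewrite invmx_unitary.
rewrite /mxfun; move: (spectral_unitarymx A).
move: (spectralmx A) (spectral_diag A) => Q m uQ.
rewrite (invmx_unitary uQ) => AQ; apply: (map_unitary_diag _ uP uQ).
by rewrite -AQ -AE.
Qed.

(** The squared modulus of the inner product of row [i] of [P] with row [j] of [Q]; [Re] only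
    changes the type. *)
Definition overlap n (P Q : 'M[C]_n) (i j : 'I_n) : R :=
  complex.Re (`|(P *m Q^t*) i j| ^+ 2).

Lemma overlapE n (P Q : 'M[C]_n) i j :
  (overlap P Q i j)%:C = `|(P *m Q^t*) i j| ^+ 2.
Proof. by rewrite RRe_real// realX// normr_real. Qed.

Lemma overlap_ge0 n (P Q : 'M[C]_n) i j : 0 <= overlap P Q i j.
Proof. by rewrite -ler0c overlapE exprn_ge0. Qed.

(** By cyclicity this is the trace of [diag l], [V], [diag m], [V^t*] multiplied in this order,
    where [V = P *m Q^t*]. *)
Lemma mxtrace_mul_diag n (P Q : 'M[C]_n) (l m : 'rV[C]_n) :
  \tr ((P^t* *m diag_mx l *m P) *m (Q^t* *m diag_mx m *m Q)) =
  \sum_i \sum_j (overlap P Q i j)%:C * (l 0 i * m 0 j).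
Proof.
pose V := P *m Q^t*.
have VE : V^t* = Q *m P^t* by rewrite /V trmx_mul map_mxM trmxCK.
rewrite -!mulmxA mxtrace_mulC !mulmxA -(mulmxA _ Q) -VE.
rewrite -(mulmxA _ P) -/V /mxtrace.
have {VE} ovE i j : (overlap P Q i j)%:C = `|V i j| ^+ 2 by exact: overlapE.
clearbody V; apply: eq_bigr => i _.
rewrite mxE; apply: eq_bigr => j _.
rewrite mul_mx_diag mul_diag_mx !mxE ovE normCK; ring.
Qed.

Lemma overlap_row n (P Q : 'M[C]_n) i :
  P \is unitarymx -> Q \is unitarymx -> \sum_j overlap P Q i j = 1.
Proof.
move=> uP uQ; apply: complexI; rewrite rmorph_sum /= rmorph1.
have uV : P *m Q^t* \is unitarymx by apply: mul_unitarymx; [exact: uP | rewrite trmxC_unitary].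
have -> : (1 : C) = (1%:M : 'M[C]_n) i i by rewrite mxE eqxx.
rewrite -(unitarymxP uV) [RHS]mxE.
by apply: eq_bigr => j _; rewrite overlapE normCK; congr (_ * _); rewrite [RHS]mxE [in RHS]mxE.
Qed.

Lemma overlapC n (P Q : 'M[C]_n) i j : overlap P Q i j = overlap Q P j i.
Proof.
apply: complexI; rewrite !overlapE.
have -> : Q *m P^t* = (P *m Q^t*)^t* by rewrite trmx_mul map_mxM trmxCK.
by rewrite !mxE norm_conjC.
Qed.

Lemma overlap_col n (P Q : 'M[C]_n) j :
  P \is unitarymx -> Q \is unitarymx -> \sum_i overlap P Q i j = 1.
Proof.
by move=> uP uQ; rewrite -(overlap_row j uQ uP); apply: eq_bigr => i _; rewrite overlapC.
Qed.

End FunctionalCalculus.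

(** * Hermitian matrices in a unitary eigenbasis *)

Section UnitaryDiag.
Local Open Scope complex_scope.
Local Open Scope sesquilinear_scope.
Variable R : realType.
Local Notation C := R[i].

(** Real eigenvalues, given as a function, let traces become real sums. *)
Definition udiag n (P : 'M[C]_n) (x : 'I_n -> R) : 'M[C]_n :=
  P^t* *m diag_mx (\row_i (x i)%:C) *m P.

Lemma mxfun_udiag (f : R -> R) n (P : 'M[C]_n) x :
  P \is unitarymx -> mxfun f (udiag P x) = udiag P (f \o x).
Proof.
move=> uP; rewrite (mxfun_unitary_diag f uP (erefl _)) /udiag.
by have -> : map_mx (fun z : C => (f (complex.Re z))%:C) (\row_i (x i)%:C) =
    \row_i ((f \o x) i)%:C by apply/rowP => i; rewrite !mxE.
Qed.

Lemma udiag1 n (P : 'M[C]_n) : P \is unitarymx -> udiag P (fun=> 1) = 1%:M.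
Proof.
move=> uP; rewrite /udiag -[RHS](mulmx_unitaryV uP); congr (_ *m _).
have -> : \row_(i < n) (1 : R)%:C = const_mx (1 : C) by apply/rowP => i; rewrite !mxE.
by rewrite diag_const_mx mulmx1.
Qed.

Lemma mxtrace_udiag_mul n (P Q : 'M[C]_n) x y :
  \tr (udiag P x *m udiag Q y) =
  (\sum_i \sum_j overlap P Q i j * (x i * y j))%:C.
Proof.
rewrite /udiag mxtrace_mul_diag rmorph_sum; apply: eq_bigr => i _ /=.
by rewrite rmorph_sum; apply: eq_bigr => j _ /=; rewrite !mxE !rmorphM.
Qed.

Lemma mxtrace_udiag_mul_same n (P : 'M[C]_n) x y : P \is unitarymx ->
  \tr (udiag P x *m udiag P y) = (\sum_i x i * y i)%:C.
Proof.
move=> uP; rewrite /udiag -!mulmxA mxtrace_mulC !mulmxA.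
rewrite -(mulmxA _ P) (unitarymxP uP) mulmx1.
rewrite -(mulmxA _ P) (unitarymxP uP) mulmx1.
rewrite rmorph_sum; apply: eq_bigr => i _ /=.
by rewrite mul_mx_diag !mxE eqxx mulr1n rmorphM.
Qed.

Lemma mxtrace_udiag n (P : 'M[C]_n) x : P \is unitarymx ->
  \tr (udiag P x) = (\sum_i x i)%:C.
Proof.
move=> uP; rewrite -[udiag P x]mulmx1 -(udiag1 uP) mxtrace_udiag_mul_same//.
by congr (_ %:C); apply: eq_bigr => i _; rewrite mulr1.
Qed.

Lemma hermsymmx_udiag n (A : 'M[C]_n) : A \is hermsymmx ->
  exists P x, P \is unitarymx /\ A = udiag P x.
Proof.
move=> hA; exists (spectralmx A), (fun i => complex.Re (spectral_diag A 0 i)).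
split; first exact: spectral_unitarymx.
have /orthomx_spectralP {1}-> := hermitian_normalmx hA.
rewrite /udiag (invmx_unitary (spectral_unitarymx A)).
have rowE : \row_i (complex.Re (spectral_diag A 0 i))%:C = spectral_diag A.
  apply/rowP => i.
  by rewrite mxE RRe_real//; exact/mxOverP/hermitian_spectral_diag_real.
by rewrite rowE.
Qed.

Lemma density_udiag n (rho : 'M[C]_n) : density_mx rho ->
  exists P p, [/\ P \is unitarymx, rho = udiag P p,
    forall i, 0 <= p i & \sum_i p i = 1].
Proof.
case=> /hermsymmx_udiag[P [p [uP rhoE]]] rho_ge0 rho1; exists P, p; split=> //.
  (* Row [i] of [P] as test vector returns the eigenvalue [p i]. *)
  move=> i; rewrite -ler0c; have := rho_ge0 (row i P).
  suff -> : (row i P *m rho *m (map_mx Num.conj (row i P)^T)) 0 0 = (p i)%:C by [].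
  have -> : (p i)%:C = (P *m rho *m P^t*) i i.
    rewrite rhoE /udiag !mulmxA (unitarymxP uP) mul1mx -(mulmxA _ P).
    by rewrite (unitarymxP uP) mulmx1 !mxE eqxx.
  rewrite -row_mul [LHS]mxE [RHS]mxE; apply: eq_bigr => j _.
  by rewrite [in LHS]mxE; congr (_ * _); rewrite !mxE.
by apply: complexI; rewrite rmorph1 -rho1 rhoE mxtrace_udiag.
Qed.

End UnitaryDiag.

(** * Partial traces *)

Section Bipartite.
Local Open Scope complex_scope.
Local Open Scope sesquilinear_scope.
Variable R : realType.
Local Notation C := R[i].

Lemma sum_mxtens (V : nmodType) m n (F : 'I_(m * n) -> V) :
  \sum_x F x = \sum_i \sum_j F (mxtens_index (i, j)).
Proof.
rewrite pair_bigA (reindex (@mxtens_index m n))/=; last first.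
  by exists (@mxtens_unindex m n) => ? _; rewrite ?mxtens_indexK ?mxtens_unindexK.
by apply: eq_bigr => -[].
Qed.

Lemma trmxC_tens m n p q (M : 'M[C]_(m, n)) (N : 'M[C]_(p, q)) :
  (M *t N)^t* = M^t* *t N^t*.
Proof. by rewrite trmx_tens map_mxT. Qed.

Lemma tens_diag_mx m n (x : 'rV[C]_m) (y : 'rV[C]_n) :
  diag_mx x *t diag_mx y =
  diag_mx (\row_k (x 0 (mxtens_unindex k).1 * y 0 (mxtens_unindex k).2)).
Proof.
apply/matrixP => i j; rewrite !mxE -(can_eq (@mxtens_unindexK m n)).
rewrite -pair_eqE /=.
by do 2![case: eqP => _]; rewrite ?mulr1n ?mulr0n ?mulr0 ?mul0r.
Qed.

Lemma unitarymx_tens m n (P : 'M[C]_m) (Q : 'M[C]_n) :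
  P \is unitarymx -> Q \is unitarymx -> P *t Q \is unitarymx.
Proof.
move=> uP uQ; apply/unitarymxP.
rewrite trmxC_tens tensmx_mul (unitarymxP uP) (unitarymxP uQ).
rewrite -!diag_const_mx tens_diag_mx; congr diag_mx.
by apply/rowP => i; rewrite !mxE mulr1.
Qed.

Lemma tens_udiag m n (P : 'M[C]_m) (Q : 'M[C]_n) x y :
  udiag P x *t udiag Q y =
  udiag (P *t Q) (fun k => x (mxtens_unindex k).1 * y (mxtens_unindex k).2).
Proof.
rewrite /udiag -!tensmx_mul tens_diag_mx trmxC_tens.
set v := (X in _ *m diag_mx X *m _ = _); set w := (X in _ = _ *m diag_mx X *m _).
by have -> : v = w by apply/rowP => k; rewrite !mxE rmorphM.
Qed.

(** Duality between the partial trace and tensoring with the identity; it lifts spectral projections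
    of a reduced state to the full space. *)
Lemma mxtrace_ptrB m n (rho : 'M[C]_(m * n)) (M : 'M[C]_m) :
  \tr (ptrB rho *m M) = \tr (rho *m (M *t 1%:M)).
Proof.
rewrite {2}/mxtrace sum_mxtens; apply: eq_bigr => i _.
under [RHS]eq_bigr do rewrite mxE sum_mxtens.
rewrite mxE exchange_big; apply: eq_bigr => k _ /=.
rewrite mxE mulr_suml; apply: eq_bigr => j _.
rewrite (bigD1 j)//= big1 ?addr0 => [|l lj].
  by rewrite tensmxE mxE eqxx mulr1.
by rewrite tensmxE [_%:M _ _]mxE (negPf lj) !mulr0.
Qed.

Lemma mxtrace_ptrA m n (rho : 'M[C]_(m * n)) (M : 'M[C]_n) :
  \tr (ptrA rho *m M) = \tr (rho *m (1%:M *t M)).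
Proof.
rewrite {2}/mxtrace sum_mxtens exchange_big; apply: eq_bigr => j _ /=.
under [RHS]eq_bigr do rewrite mxE sum_mxtens exchange_big /=.
rewrite mxE exchange_big; apply: eq_bigr => l _ /=.
rewrite mxE mulr_suml; apply: eq_bigr => i _.
rewrite (bigD1 i)//= big1 ?addr0 => [|k ki].
  by rewrite tensmxE mxE eqxx mul1r.
by rewrite tensmxE [_%:M _ _]mxE (negPf ki) mul0r mulr0.
Qed.

Lemma hermsymmxE n (A : 'M[C]_n) : A \is hermsymmx <-> A^t* = A.
Proof.
split=> [/is_hermitianmxP|hA].
  by rewrite expr0 scale1r => <-.
by apply/is_hermitianmxP; rewrite expr0 scale1r hA.
Qed.

Lemma hermsymmx_ptrB m n (rho : 'M[C]_(m * n)) :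
  rho \is hermsymmx -> ptrB rho \is hermsymmx.
Proof.
move=> /hermsymmxE hrho; apply/hermsymmxE/matrixP => i k; rewrite !mxE rmorph_sum.
by apply: eq_bigr => j _; rewrite -[in RHS]hrho !mxE.
Qed.

Lemma hermsymmx_ptrA m n (rho : 'M[C]_(m * n)) :
  rho \is hermsymmx -> ptrA rho \is hermsymmx.
Proof.
move=> /hermsymmxE hrho; apply/hermsymmxE/matrixP => i k; rewrite !mxE rmorph_sum.
by apply: eq_bigr => j _; rewrite -[in RHS]hrho !mxE.
Qed.

(** * Spectra of the reduced states as marginals *)

Section Marginals.
Variables (m n : nat) (rho : 'M[C]_(m * n)) (P : 'M[C]_(m * n)) (p : 'I_(m * n) -> R).
Variables (U : 'M[C]_m) (a : 'I_m -> R) (V : 'M[C]_n) (b : 'I_n -> R).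
Hypotheses (uU : U \is unitarymx) (uV : V \is unitarymx).
Hypotheses (rhoE : rho = udiag P p).

(** Here [a k] is the trace of the reduced state against the projection onto its [k]-th eigenvector.
    Writing the other identity factor in the basis [V] makes the lifted projection diagonal in the
    product basis. *)
Lemma eigen_ptrB k : ptrB rho = udiag U a ->
  a k = \sum_(j | (mxtens_unindex j).1 == k) \sum_i overlap P (U *t V) i j * p i.
Proof.
move=> rhoA; apply: complexI.
transitivity (\tr (ptrB rho *m udiag U (fun l => (l == k)%:R))).
  rewrite rhoA mxtrace_udiag_mul_same//; congr (_ %:C).
  by rewrite (bigD1 k)//= eqxx mulr1 big1 ?addr0// => l /negPf->; rewrite mulr0.
rewrite mxtrace_ptrB -(udiag1 uV) tens_udiag rhoE mxtrace_udiag_mul; congr (_ %:C).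
rewrite exchange_big [RHS]big_mkcond; apply: eq_bigr => j _ /=.
by case: eqP => _; [apply: eq_bigr => i _|apply: big1 => i _]; rewrite !(mulr0, mulr1, mul0r).
Qed.

Lemma eigen_ptrA k : ptrA rho = udiag V b ->
  b k = \sum_(j | (mxtens_unindex j).2 == k) \sum_i overlap P (U *t V) i j * p i.
Proof.
move=> rhoB; apply: complexI.
transitivity (\tr (ptrA rho *m udiag V (fun l => (l == k)%:R))).
  rewrite rhoB mxtrace_udiag_mul_same//; congr (_ %:C).
  by rewrite (bigD1 k)//= eqxx mulr1 big1 ?addr0// => l /negPf->; rewrite mulr0.
rewrite mxtrace_ptrA -(udiag1 uU) tens_udiag rhoE mxtrace_udiag_mul; congr (_ %:C).
rewrite exchange_big [RHS]big_mkcond; apply: eq_bigr => j _ /=.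
by case: eqP => _; [apply: eq_bigr => i _|apply: big1 => i _]; rewrite !(mulr0, mulr1, mul1r).
Qed.

End Marginals.

(** * Hellinger distance and relative entropy as sums over overlaps *)

Lemma mxtrace_sqrB n (X Y : 'M[C]_n) :
  \tr ((X - Y) ^+ 2) = \tr (X *m X) - \tr (X *m Y) - (\tr (X *m Y) - \tr (Y *m Y)).
Proof.
have -> : (X - Y) ^+ 2 = (X - Y) *m (X - Y) by rewrite expr2.
by rewrite mulmxBl !mulmxBr !raddfB /= [\tr (Y *m X)]mxtrace_mulC.
Qed.

Lemma hellinger2_udiag n (P Q : 'M[C]_n) (p q : 'I_n -> R) :
  P \is unitarymx -> Q \is unitarymx ->
  hellinger2 (udiag P p) (udiag Q q) =
  \sum_i \sum_j overlap P Q i j * (Num.sqrt (p i) - Num.sqrt (q j)) ^+ 2.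
Proof.
move=> uP uQ; rewrite /hellinger2 /mxsqrt !mxfun_udiag//.
rewrite mxtrace_sqrB !mxtrace_udiag_mul_same// mxtrace_udiag_mul.
rewrite -!rmorphB /=.
(* Unit row and column sums spread both diagonal sums over all pairs, so that the three sums combine
   into a square. *)
have -> : \sum_i (Num.sqrt \o p) i * (Num.sqrt \o p) i =
    \sum_i \sum_j overlap P Q i j * (Num.sqrt (p i) * Num.sqrt (p i)).
  by apply: eq_bigr => i _; rewrite -mulr_suml overlap_row// mul1r.
have -> : \sum_i (Num.sqrt \o q) i * (Num.sqrt \o q) i =
    \sum_i \sum_j overlap P Q i j * (Num.sqrt (q j) * Num.sqrt (q j)).
  by rewrite exchange_big; apply: eq_bigr => j _; rewrite -mulr_suml overlap_col// mul1r.
rewrite -!sumrB; apply: eq_bigr => i _; rewrite -!sumrB; apply: eq_bigr => j _ /=.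
ring.
Qed.

Lemma relent_udiag n (P Q : 'M[C]_n) (p q : 'I_n -> R) :
  P \is unitarymx -> Q \is unitarymx ->
  relent (udiag P p) (udiag Q q) =
  \sum_i \sum_j overlap P Q i j * (p i * (ln0 (p i) - ln0 (q j))).
Proof.
move=> uP uQ; rewrite /relent /mxlog !mxfun_udiag// mulmxBr.
rewrite [\tr _]raddfB /= mxtrace_udiag_mul_same// mxtrace_udiag_mul -rmorphB /=.
rewrite -sumrB; apply: eq_bigr => i _.
rewrite -[X in X - _]mul1r -(overlap_row i uP uQ) mulr_suml -sumrB.
by apply: eq_bigr => j _ /=; ring.
Qed.

End Bipartite.

(** * From bipartite states to the coupling inequality *)

Theorem theorem4p1 (R : realType) :
  exists c : R, 0 < c /\
    forall (d : nat) (rho : 'M[R[i]]_(d * d)),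
      density_mx rho ->
      let eta := hellinger2 rho (ptrB rho *t ptrA rho) in
      mutinf rho <= c * eta * ln (d%:R / eta).
Proof.
exists 36; split=> // d rho rho_density /=.
have [rho_herm _ _] := rho_density.
have [P [p [uP rhoE p_ge0 p_sum]]] := density_udiag rho_density.
have [U [a [uU rhoA]]] := hermsymmx_udiag (hermsymmx_ptrB rho_herm).
have [V [b [uV rhoB]]] := hermsymmx_udiag (hermsymmx_ptrA rho_herm).
have uUV := unitarymx_tens uU uV.
(* Each reduced spectrum is a marginal of weights of total mass 1; applied to both, this shows that
   the product eigenvalues sum to 1. *)
have sum_marginal (c : 'I_d -> R) (gamma : 'I_(d * d) -> 'I_d) :
    (forall k, c k = \sum_(j | gamma j == k) \sum_i overlap P (U *t V) i j * p i) ->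
    \sum_k c k = 1.
  move=> cE; under eq_bigr do rewrite cE.
  transitivity (\sum_j \sum_i overlap P (U *t V) i j * p i).
    by rewrite [RHS](partition_big gamma predT).
  rewrite exchange_big -[RHS]p_sum.
  by apply: eq_bigr => i _; rewrite -mulr_suml (overlap_row i uP uUV) mul1r.
have aE k := eigen_ptrB uU uV rhoE k rhoA.
have bE k := eigen_ptrA uU uV rhoE k rhoB.
rewrite /mutinf rhoA rhoB tens_udiag rhoE.
rewrite (hellinger2_udiag _ _ uP uUV) (relent_udiag _ _ uP uUV).
apply: (@kl_le_hell R _ _ d (fun j => (mxtens_unindex j).1)
  (fun j => (mxtens_unindex j).2) p a b (overlap P (U *t V))).
- by rewrite card_ord.
- exact: overlap_ge0.
- by move=> i; exact: overlap_row.
- by move=> j; exact: overlap_col.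
- exact: p_ge0.
- exact: p_sum.
- by rewrite -mulr_sum (sum_marginal _ _ aE) (sum_marginal _ _ bE) mulr1.
- exact: aE.
- exact: bE.
Qed.
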